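(* Let $n\ge1$. The following statements hold. (i) If $A\subseteq(\mathbb{F}_9^\times)^n$ contains no nontrivial three-term arithmetic progression (equivalently, if it is a cap set in the underlying $\mathbb{F}_3$-space $\mathbb{F}_9^n\cong\mathbb{F}_3^{2n}$), then $$|A|\le3\,\vartheta_9^n,\qquad\vartheta_9\approx7.4810579074.$$ Moreover, with $x_0=\frac{1+\sqrt{33}}4$ and $\gamma=(1+x_0+x_0^2)x_0^{-4/3}$, one has $$\vartheta_9<\gamma^2\approx7.5906014287 .$$ (Thus the exponential base is smaller than the base $\gamma^2$ given by the Ellenberg–Gijswijt cap-set bound in $\mathbb{F}_3^{2n}$.) (ii) If $A\subseteq(\mathbb{F}_5^\times)^n$ contains no five pairwise distinct elements whose sum is zero, then $$|A|\le120\,\vartheta_5^n,\qquad\vartheta_5\approx3.9556902435<2\sqrt5\approx4.4721359550.$$ (Thus the exponential base is smaller than the base $2\sqrt5$ inherited from Sauermann's full-space theorem.)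
   Context: $\mathbb{F}_q^\times=\mathbb{F}_q\setminus\{0\}$, and $\vartheta_q=\inf_{0<\rho<1}(1+\rho+\cdots+\rho^{q-2})\rho^{-(q-1)/3}$. A nontrivial three-term arithmetic progression in an $\mathbb{F}_3$-vector space is a triple $x,x+d,x+2d$ with $d\ne0$; in characteristic three this is the same as three pairwise distinct elements summing to zero. A cap set is a set containing no such progression. *)

(* Defs.v *)
From HB Require Import structures.
From mathcomp Require Import all_boot all_order all_algebra.
From mathcomp Require Import all_classical all_reals all_analysis.

Set Implicit Arguments.
Unset Strict Implicit.
Unset Printing Implicit Defensive.

Import Order.TTheory GRing.Theory Num.Theory.
Local Open Scope ring_scope.

(* The real exponent (q - 1) / 3 is handled by powR; q - 1 is a natural
   number subtraction, so q >= 1 is intended. *)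
Definition vartheta (R : realType) (q : nat) : R :=
  inf [set (\sum_(i < q - 1) rho ^+ i) * rho `^ (- ((q - 1)%:R / 3))
      | rho in [set rho : R | 0 < rho < 1]]%classic.

Definition x0 (R : realType) : R := (1 + Num.sqrt 33) / 4.

Definition gamma (R : realType) : R :=
  (1 + x0 R + x0 R ^+ 2) * x0 R `^ (- (4 / 3)).

Definition punctured_box (F : finFieldType) (n : nat) : {set 'rV[F]_n} :=
  [set x : 'rV[F]_n | [forall i, x ord0 i != 0]].

(* Only the additive structure matters: x + d *+ 2 is x + 2d. *)
Definition ap3_free (V : finZmodType) (A : {set V}) : Prop :=
  forall x d : V, d != 0 -> ~ [/\ x \in A, x + d \in A & x + d *+ 2 \in A].

Definition cap_set (m : nat) (B : {set 'rV['F_3]_m}) : Prop := ap3_free B.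

Definition no_five_zero_sum (V : finZmodType) (A : {set V}) : Prop :=
  forall B : {set V}, B \subset A -> #|B| = 5%N -> \sum_(x in B) x <> 0.

(* decimal R [:: d0; d1; d2; ...] is d0.d1d2...; digit lists avoid large
   unary literals. *)
Definition decimal (R : realType) (s : seq nat) : R :=
  foldr (fun d x => d%:R + x / 10) 0 s.

(* x equals the decimal expansion s up to half a unit in its last place. *)
Definition rounds_to (R : realType) (x : R) (s : seq nat) : Prop :=
  `|x - decimal R s| <= 2^-1 / 10 ^+ (size s).-1.

(* Main.v *)
Require Import Defs.
From HB Require Import structures.
From mathcomp Require Import all_boot all_order all_algebra.
From mathcomp Require Import all_field.
From mathcomp Require Import all_classical all_reals all_analysis.
From mathcomp Require Import fintype finset.
From mathcomp Require Import ring lra.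

Set Implicit Arguments.
Unset Strict Implicit.
Unset Printing Implicit Defensive.

Import Order.TTheory GRing.Theory Num.Theory.
Local Open Scope ring_scope.

(** Both cardinality bounds are slice-rank arguments, in the partition-rank
form due to Naslund.  Let [A] lie in the box of vectors over a field with
[Q.+1] elements all of whose coordinates are nonzero, and let [T] be a function
of [k] vectors whose restriction to [A^k] vanishes exactly off the diagonal.
If [T] is a sum of [N] products [f * g], where [f] and [g] read complementary
nonempty groups of the [k] vectors, then [#|A| <= N]
([diagonal_partition_rank]).

On the box every coordinate satisfies [z ^+ Q = 1], so the indicator of
[x_1 + ... + x_k = 0] is homogeneous of degree [Q] in each of the [n]
coordinates, and every exponent in it may be reduced modulo [Q].  This
reduction is the gain over the full space: only exponents [0 .. Q - 1] remain,
while the total degree is still at most [Q * n].  Multiply the indicator by the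
condition that the [x_i] agree along a partition with at least three blocks.
In each monomial one block carries at most a third of the degree; slicing on
that block costs one product for each pair of a block and an exponent vector of
degree at most [Q * n / 3] ([sliceable_zero_sum]).  The number of such exponent
vectors is at most [vartheta ^+ n] ([card_low_exponents_vartheta]), by the
usual Chernoff weighting with [rho ^+ degree].

For progressions in characteristic three, [T] is the zero-sum indicator
itself, sliced on the three singletons.  For [p] pairwise distinct elements,
the indicator of distinctness is the product over [j] of
[1 - #{i < j | x_i = x_j}].  Expanded, it is a signed sum, over forests [c]
with [c j <= j], of the conditions that [x] is constant on the trees of [c].
When the [x_i] sum to zero, a forest with at most two trees only sees the
diagonal, because [p] is prime ([two_roots_constant]); so these forests are
dropped from [T].  What is left on the diagonal is the sum of the coefficients
of degree at least three in [X (X - 1) ... (X - p + 1) = X^p - X], that is, one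
([sum_forest_sign_many_roots]).

For the numerical values, [vartheta] is the infimum of a sum of exponentials
in [ln rho].  Bounding each exponential from below by its tangent at a rational
point near the minimizer gives rational lower bounds
([vartheta_tangent_bound]); evaluating at that point gives the upper ones.
Finally [gamma ^+ 3 = 27 / 512 * (207 + 33 * sqrt 33)] ([gamma_cube]). *)

(** * The partition rank of a diagonal tensor *)

(** The orthogonality conditions define a space of dimension at least
[#|A| - #|P|]; picking that many independent columns of a basis of it, some
vector of the space takes the value one at each of them. *)
Lemma large_support_orthogonal (F : fieldType) (X J : finType) (A : {set X})
    (P : {pred J}) (u : J -> X -> F) :
  exists h : X -> F,
    [/\ forall a, a \notin A -> h a = 0,
        forall j, j \in P -> \sum_(a in A) h a * u j a = 0
      & (#|A| <= #|[set a in A | h a != 0%R]| + #|P|)%N].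
Proof.
pose M : 'M[F]_(#|A|, #|P|) := \matrix_(i, j) u (enum_val j) (enum_val i).
pose K := row_base (kermx M).
have fullK : row_full K^T by rewrite /row_full mxrank_tr -/(row_free K) row_base_free.
pose f := fullrankfun fullK.
pose B := rowsub f K^T.
have unitB : B \in unitmx by apply: fullrowsub_unit.
pose c : 'cV[F]_(\rank (kermx M)) := invmx B *m const_mx 1.
pose v : 'rV[F]_#|A| := c^T *m K.
have v1 i : v ord0 (f i) = 1.
  have : (B *m c) i ord0 = 1 by rewrite mulKVmx // mxE.
  rewrite mxE => <-; rewrite mxE; apply: eq_bigr => k _.
  by rewrite !mxE mulrC.
have vM : v *m M = 0.
  apply/sub_kermxP; apply: submx_trans (submxMl _ _) _.
  by rewrite eq_row_base.
pose h a := \sum_(i : 'I_#|A| | enum_val i == a) v ord0 i.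
have hE (i : 'I_#|A|) : h (enum_val i) = v ord0 i.
  by rewrite /h (big_pred1 i) // => k; rewrite (inj_eq enum_val_inj).
exists h; split=> [a aA|j jP|].
- rewrite /h big_pred0 // => i; apply/negP => /eqP ia.
  by rewrite -ia enum_valP in aA.
- rewrite big_enum_val /=.
  have := congr1 (fun N : 'rV_#|P| => N ord0 (enum_rank_in jP j)) vM.
  rewrite mxE [RHS]mxE => e; rewrite -[RHS]e; apply: eq_bigr => i _.
  by rewrite hE [M _ _]mxE enum_rankK_in.
have rk : (#|A| - #|P| <= \rank (kermx M))%N.
  by rewrite mxrank_ker leq_sub2l ?rank_leq_col.
rewrite addnC -leq_subLR; apply: leq_trans rk _.
rewrite -[leqLHS]card_ord -(card_imset _ (inj_comp enum_val_inj (@fullrankfun_inj _ _ _ _ fullK))).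
apply/subset_leq_card/subsetP => _ /imsetP[i _ ->].
by rewrite inE hE v1 oner_eq0 andbT enum_valP.
Qed.

Definition depends_on (I : finType) (X R : Type) (S : {set I}) (f : (I -> X) -> R) :=
  forall x y : I -> X, {in S, x =1 y} -> f x = f y.

Definition constant_on (I : finType) (X : eqType) (D : {set I}) (x : I -> X) :=
  [forall i in D, forall k in D, x i == x k].

Lemma constant_onP (I : finType) (X : eqType) (D : {set I}) (x : I -> X) :
  reflect {in D &, forall i k, x i = x k} (constant_on D x).
Proof.
apply: (iffP 'forall_in_'forall_in_eqP) => c i; first by move=> k Di; apply: c.
by move=> Di k; apply: c.
Qed.

(** By induction on the number of variables in [D].  Fix [d] in [D] and
sum out the variable [d] against a weight [h] on [A] which is orthogonal to
all the factors depending on [x d] alone.  This kills the corresponding terms,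
keeps the others as products over a proper partition of [D :\ d], and leaves a
tensor that is diagonal on the support of [h]; that support has lost at most
one point of [A] for each killed term. *)
Lemma diagonal_partition_rank (F : fieldType) (I J X : finType)
    (D : {set I}) (A : {set X}) (P : {set J}) (S : J -> {set I})
    (f g : J -> (I -> X) -> F) :
  D != set0 ->
  (forall j, j \in P -> S j != set0 /\ S j \proper D) ->
  (forall j, j \in P -> depends_on (S j) (f j)) ->
  (forall j, j \in P -> depends_on (D :\: S j) (g j)) ->
  (forall x, (forall i, x i \in A) ->
     (\sum_(j in P) f j x * g j x != 0) = constant_on D x) ->
  (#|A| <= #|P|)%N.
Proof.
move: {2}#|D| (leqnn #|D|) => m.
elim: m => [|m IHm] in D A P S f g *.
  by rewrite leqn0 cards_eq0 => ->.
move=> leDm /set0Pn[d dD] SD fS gS TA.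
have [D1|D'0] := eqVneq (D :\ d) set0.
  suff [-> _] : A = set0 /\ P = set0 by rewrite cards0.
  have P0 : P = set0.
    apply/setP=> j; rewrite inE; apply/negP => jP; have [S0 Sp] := SD j jP.
    have eD : D = [set d] by rewrite -(setD1K dD) D1 setU0.
    by move: Sp; rewrite eD properEcard cards1 ltnS leqn0 cards_eq0 (negbTE S0) andbF.
  split=> //; apply/setP=> a; rewrite inE; apply/negP => aA.
  have := TA (fun=> a) (fun=> aA); rewrite P0 big_set0 eqxx.
  by move/esym/negP; apply; apply/constant_onP.
pose P1 := [set j in P | (S j == [set d]) || (S j == D :\ d)].
(* A term is killed when either of its two factors reads [x d] alone. *)
pose u j a := if S j == [set d] then f j (fun=> a) else g j (fun=> a).
have [h [hA hu Ah]] := large_support_orthogonal A (mem P1) u.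
pose A' := [set a in A | h a != 0].
suff {Ah} : (#|A'| <= #|P :\: P1|)%N.
  have sP1 : P1 \subset P by apply/subsetP=> j; rewrite inE => /andP[].
  rewrite cardsD (setIidPr sP1) => le2; apply: leq_trans Ah _.
  by rewrite addnC -leq_subRL ?subset_leq_card.
pose upd (x : I -> X) a := [eta x with d |-> a].
pose f' j x := if d \in S j then \sum_(a in A) h a * f j (upd x a) else f j x.
pose g' j x := if d \in S j then g j x else \sum_(a in A) h a * g j (upd x a).
apply: (IHm (D :\ d) A' (P :\: P1) (fun j => S j :\ d) f' g') => //.
- by move: leDm; rewrite (cardsD1 d D) dD.
- move=> j; rewrite !inE => /andP[nP1 jP]; move: nP1; rewrite jP /= negb_or => /andP[n1 n2].
  have [S0 /properP[SDj [e eD eS]]] := SD j jP; split.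
    apply: contra n1 => /eqP Sd0; rewrite eqEsubset -setD_eq0 Sd0 eqxx /=.
    rewrite sub1set; apply: contraR S0 => dS; rewrite -Sd0.
    by apply/eqP/setP=> i; rewrite !inE; case: eqP => [->|]; rewrite ?(negbTE dS).
  rewrite properEneq setSD // andbT; apply: contra n2 => /eqP eSD.
  rewrite -eSD; apply/eqP/setP=> i; rewrite !inE; case: eqP => // ->.
  apply/negP=> dS; have : e \in S j :\ d; last by rewrite !inE (negbTE eS) andbF.
  by rewrite eSD !inE eD andbT; apply: contraNneq eS => ->.
- move=> j /setDP[jP _] x y xy; rewrite /f'; case: ifP => dS.
    apply: eq_bigr => a _; congr (_ * _); apply: (fS j jP) => i iS /=.
    by case: eqP => // /eqP nid; apply: xy; rewrite /= !inE nid.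
  apply: (fS j jP) => i iS; apply: xy; rewrite !inE iS andbT.
  by apply: contraFneq dS => <-.
- move=> j /setDP[jP _] x y xy; rewrite /g'; case: ifP => dS.
    apply: (gS j jP) => i iS; apply: xy; move: iS; rewrite /= !inE => /andP[iS iD].
    by rewrite iD (negbTE iS) !andbF andbT; apply: contraNneq iS => ->.
  apply: eq_bigr => a _; congr (_ * _); apply: (gS j jP) => i iS /=.
  case: eqP => // /eqP nid; apply: xy; move: iS; rewrite /= !inE => /andP[iS iD].
  by rewrite nid iD (negbTE iS).
move=> x xA'.
have xA i : x i \in A by move: (xA' i); rewrite inE => /andP[].
(* The new terms add up to the old tensor summed out against [h]. *)
have -> : \sum_(j in P :\: P1) f' j x * g' j x =
          \sum_(a in A) h a * \sum_(j in P) f j (upd x a) * g j (upd x a).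
  under [RHS]eq_bigr do rewrite big_distrr /=.
  rewrite exchange_big /= [RHS](bigID (mem P1)) /= [X in _ = X + _]big1 ?add0r => [|j /andP[jP jP1]].
    apply: eq_big => [j|j /setDP[jP _]]; first by rewrite inE andbC.
    rewrite /f' /g'; case: ifP => dS.
      rewrite big_distrl; apply: eq_bigr => a _ /=; rewrite mulrA; congr (_ * _).
      apply: (gS j jP) => i /=; rewrite !inE => /andP[iS _].
      by case: eqP => // eid; rewrite eid dS in iS.
    rewrite big_distrr; apply: eq_bigr => a _ /=; rewrite mulrCA; congr (_ * (_ * _)).
    apply: (fS j jP) => i /= iS.
    by case: eqP => // eid; rewrite -eid iS in dS.
  have := hu j jP1; rewrite /u.
  move: jP1; rewrite inE jP /=; case: eqP => /= [Sd _|_ /eqP Sd] h0.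
    transitivity ((\sum_(a in A) h a * f j (fun=> a)) * g j x); last by rewrite h0 mul0r.
    rewrite big_distrl; apply: eq_bigr => a _ /=.
    rewrite mulrA; congr (_ * _ * _).
      by apply: (fS j jP) => i; rewrite /= Sd inE => ->.
    apply: (gS j jP) => i /=; rewrite Sd !inE => /andP[/negbTE-> _] //.
  transitivity (f j x * \sum_(a in A) h a * g j (fun=> a)); last by rewrite h0 mulr0.
  rewrite big_distrr; apply: eq_bigr => a _ /=.
  rewrite mulrCA; congr (_ * (_ * _)).
    by apply: (fS j jP) => i /=; rewrite Sd !inE => /andP[/negbTE-> _].
  apply: (gS j jP) => i /=; rewrite Sd !inE => /andP[+ iD].
  by rewrite iD andbT negbK => ->.
have updA a i : a \in A -> upd x a i \in A by move=> aA /=; case: ifP.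
have [e eD'] := set0Pn _ D'0; have /setD1P[ed eD] := eD'.
case: (boolP (constant_on _ x)) => [/constant_onP xc|xc].
  rewrite (bigD1 (x e)) //= [X in _ + X]big1 ?addr0 => [|a /andP[aA ax]].
    rewrite mulf_neq0 //; first by move: (xA' e); rewrite inE => /andP[].
    rewrite TA => [|i]; last exact: updA.
    apply/constant_onP => i k iD kD /=.
    by case: (eqVneq i d) (eqVneq k d) => [_|ni] [_|nk] //; apply: xc; rewrite // !inE ?ni ?nk.
  apply/eqP; rewrite mulf_eq0; apply/orP; right; rewrite -[_ == _]negbK.
  rewrite TA => [|i]; last exact: updA.
  apply/constant_onP => c; have := c d e dD eD; rewrite /= eqxx (negbTE ed) => ae.
  by rewrite ae eqxx in ax.
rewrite [X in X != 0]big1 ?eqxx // => a aA.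
apply/eqP; rewrite mulf_eq0; apply/orP; right; rewrite -[_ == _]negbK.
rewrite TA => [|i]; last exact: updA.
apply: contra xc => /constant_onP c; apply/constant_onP=> i k.
move=> /setD1P[ni iD] /setD1P[nk kD].
by have := c i k iD kD; rewrite /= (negbTE ni) (negbTE nk).
Qed.

(** * Slicing along blocks of low degree *)

Definition monomial_value (F : finFieldType) (n Q : nat)
    (e : {ffun 'I_n -> 'I_Q}) (v : 'rV[F]_n) : F :=
  \prod_l v ord0 l ^+ e l.

Definition low_exponents (n Q : nat) : {set {ffun 'I_n -> 'I_Q}} :=
  [set e : {ffun 'I_n -> 'I_Q} | (3 * \sum_l e l <= Q * n)%N].

Definition block_monomial (F : finFieldType) (n Q : nat) (I : finType)
    (S : {set I}) (e : {ffun 'I_n -> 'I_Q}) (x : I -> 'rV[F]_n) : F :=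
  if [pick i in S] is Some i then (constant_on S x)%:R * monomial_value e (x i)
  else 0.

(** [T] agrees on the box with a sum of [#|SS| * #|low_exponents n Q|] products
whose left factors are prescribed: a monomial of low degree in the common value
of a block [S] in [SS].  Fixing the left factors makes the property stable
under sums with no increase in the number of products. *)
Definition sliceable (F : finFieldType) (n Q : nat) (I : finType)
    (SS : {set {set I}}) (T : (I -> 'rV[F]_n) -> F) :=
  exists2 g : {set I} -> {ffun 'I_n -> 'I_Q} -> (I -> 'rV[F]_n) -> F,
    forall S e, depends_on (~: S) (g S e) &
    forall x, (forall i, x i \in punctured_box F n) ->
      T x = \sum_(S in SS) \sum_(e in low_exponents n Q)
              block_monomial S e x * g S e x.

Section Sliceable.
Variables (F : finFieldType) (n Q : nat) (I : finType) (SS : {set {set I}}).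
Implicit Type T : (I -> 'rV[F]_n) -> F.

Lemma eq_sliceable T T' :
  (forall x, (forall i, x i \in punctured_box F n) -> T x = T' x) ->
  sliceable Q SS T -> sliceable Q SS T'.
Proof. by move=> eT [g g1 g2]; exists g => // x xB; rewrite -eT // g2. Qed.

Lemma sliceableZ (c : F) T : sliceable Q SS T -> sliceable Q SS (fun x => c * T x).
Proof.
move=> [g g1 g2]; exists (fun S e x => c * g S e x) => [S e x y xy|x xB].
  by rewrite (g1 S e x y).
rewrite g2 // big_distrr; apply: eq_bigr => S _ /=; rewrite big_distrr.
by apply: eq_bigr => e _; apply: mulrCA.
Qed.

Lemma sliceable_sum (K : Type) (r : seq K) (P : pred K) (T : K -> (I -> 'rV[F]_n) -> F) :
  (forall k, P k -> sliceable Q SS (T k)) ->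
  sliceable Q SS (fun x => \sum_(k <- r | P k) T k x).
Proof.
move=> sT; elim: r => [|k r [g g1 g2]].
  exists (fun _ _ _ => 0) => // x _; rewrite big_nil big1 // => S _.
  by rewrite big1 // => e _; rewrite mulr0.
case Pk: (P k); last first.
  by exists g => // x xB; rewrite big_cons Pk g2.
have [g' g1' g2'] := sT k Pk.
exists (fun S e x => g' S e x + g S e x) => [S e x y xy|x xB].
  by rewrite (g1 S e x y) // (g1' S e x y).
rewrite big_cons Pk g2 // g2' // -big_split; apply: eq_bigr => S _.
by rewrite -big_split; apply: eq_bigr => e _; rewrite mulrDr.
Qed.

Lemma sliceable_block S e (g : (I -> 'rV[F]_n) -> F) :
  S \in SS -> e \in low_exponents n Q -> depends_on (~: S) g ->
  sliceable Q SS (fun x => block_monomial S e x * g x).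
Proof.
move=> SSS eE gS.
exists (fun S' e' x => if (S' == S) && (e' == e) then g x else 0).
  by move=> S' e' x y xy; case: ifP => // /andP[/eqP eS _]; apply: gS; rewrite -eS.
move=> x _; rewrite (bigD1 S) //= (bigD1 e) //= !eqxx /=.
rewrite [X in _ + X + _]big1 ?addr0 => [|e' /andP[_ /negbTE->]]; last by rewrite mulr0.
rewrite big1 ?addr0 // => S' /andP[_ /negbTE->].
by apply: big1 => e' _; rewrite mulr0.
Qed.

Lemma sliceable_diagonal_bound T (A : {set 'rV[F]_n}) (i0 : I) :
  (forall S, S \in SS -> S != set0 /\ S \proper [set: I]) ->
  A \subset punctured_box F n -> sliceable Q SS T ->
  (forall x, (forall i, x i \in A) -> (T x != 0) = constant_on [set: I] x) ->
  (#|A| <= #|SS| * #|low_exponents n Q|)%N.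
Proof.
move=> SSp /subsetP AB [g g1 g2] TA.
rewrite -cardsX.
apply: (@diagonal_partition_rank F I _ _ setT A _ (fun j => j.1)
  (fun j => @block_monomial F n Q I j.1 j.2) (fun j => g j.1 j.2)).
- by apply/set0Pn; exists i0; rewrite inE.
- by move=> [S e] /setXP[/SSp].
- move=> [S e] _ x y xy; rewrite /block_monomial /=; case: pickP => // i iS.
  rewrite xy //; congr ((_ : bool)%:R * _).
  apply: eq_forallb_in => j jS; apply: eq_forallb_in => k kS.
  by rewrite !xy.
- move=> [S e] _; rewrite setTD; exact: g1.
move=> x xA; rewrite -TA // g2 => [|i]; last exact: AB.
rewrite pair_big_dep /=; congr (_ != 0).
by apply: eq_bigl => -[S e]; rewrite in_setX.
Qed.

End Sliceable.

Section ZeroSum.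
Variables (F : finFieldType) (n Q : nat) (I : finType).
Hypothesis cardF : #|F| = Q.+1.

Let expQ (z : F) : z != 0 -> z ^+ Q = 1.
Proof.
move=> z0; apply: (mulfI z0); rewrite mulr1 -exprS -cardF; exact: expf_card.
Qed.

Let Q_gt0 : (0 < Q)%N.
Proof. by rewrite -ltnS -cardF finNzRing_gt1. Qed.

(** On the box [1 = x i0 l ^+ Q] for each coordinate [l], so the factor
[1 - (\sum_i x i l) ^+ Q] of the indicator is homogeneous of degree [Q]; its
monomials are indexed by the functions choosing a vector for each of the [Q]
factors. *)
Lemma zero_sum_expansion (i0 : I) :
  exists c : {ffun 'I_n -> {ffun 'I_Q -> I}} -> F,
  forall x : I -> 'rV[F]_n, (forall i, x i \in punctured_box F n) ->
    (\sum_i x i == 0)%:R =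
    \sum_U c U * \prod_l \prod_t x (U l t) ord0 l :> F.
Proof.
pose w (u : {ffun 'I_Q -> I}) : F := (u == [ffun=> i0])%:R - 1.
exists (fun U => \prod_l w (U l)) => x xB.
have -> : (\sum_i x i == 0)%:R = \prod_l (1 - (\sum_i x i ord0 l) ^+ Q).
  case: eqP => [x0|/eqP x0].
    rewrite big1 // => l _.
    suff -> : \sum_i x i ord0 l = 0 by rewrite expr0n -leqn0 leqNgt Q_gt0 subr0.
    by rewrite -summxE x0 mxE.
  case/rV0Pn: x0 => l xl; rewrite (bigD1 l) //= expQ ?subrr ?mul0r //.
  by rewrite -summxE.
transitivity (\prod_l \sum_(u : {ffun 'I_Q -> I}) w u * \prod_t x (u t) ord0 l).
  apply: eq_bigr => l _.
  rewrite /w. under [RHS]eq_bigr do rewrite mulrBl mul1r.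
  rewrite sumrB; congr (_ - _).
    rewrite (bigD1 [ffun=> i0]) //= [X in _ + X]big1 ?addr0 => [|u /negbTE->];
      last by rewrite mul0r.
    rewrite eqxx mul1r; under eq_bigr do rewrite ffunE.
    rewrite prodr_const card_ord expQ //.
    by have := xB i0; rewrite inE => /forallP.
  by rewrite -(bigA_distr_bigA (fun (t : 'I_Q) i => x i ord0 l)) prodr_const card_ord.
rewrite bigA_distr_bigA; apply: eq_bigr => U _.
by rewrite big_split.
Qed.

(** The partition is given by the idempotent map [rho] sending each index to the
representative of its block.  A monomial of the zero-sum indicator has total
degree [Q * n], which is shared by at least three blocks, so one of them has
degree at most [Q * n / 3]. *)
Lemma sliceable_zero_sum (SS : {set {set I}}) (rho : I -> I) (i0 : I) :
  (forall i, rho (rho i) = rho i) -> (2 < #|[set r | rho r == r]|)%N ->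
  (forall r, rho r = r -> [set i | rho i == r] \in SS) ->
  sliceable Q SS (fun x : I -> 'rV[F]_n =>
    [forall i, x i == x (rho i)]%:R * (\sum_i x i == 0)%:R).
Proof.
move=> rhoK roots3 SSrho; have [c xc] := zero_sum_expansion i0.
pose delta (x : I -> 'rV[F]_n) : F := [forall i, x i == x (rho i)]%:R.
apply: (@eq_sliceable _ _ _ _ _ (fun x => \sum_U c U *
   (delta x * \prod_l \prod_t x (U l t) ord0 l))).
  move=> x xB; rewrite xc // big_distrr; apply: eq_bigr => U _; exact: mulrCA.
apply: sliceable_sum => U _; apply: sliceableZ.
(* [deg r] is the degree of the monomial [U] in the block represented by [r]. *)
pose deg r := (\sum_(l < n) \sum_(t < Q) (rho (U l t) == r))%N.
have sumdeg : (\sum_(r | rho r == r) deg r = n * Q)%N.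
  rewrite exchange_big /=; under eq_bigr do rewrite exchange_big /=.
  rewrite (eq_bigr (fun=> Q)) ?sum_nat_const ?card_ord // => l _.
  rewrite (eq_bigr (fun=> 1%N)) ?sum1_card ?card_ord // => t _.
  rewrite (bigD1 (rho (U l t))) ?rhoK //= eqxx big1 // => r /andP[_].
  by rewrite eq_sym => /negbTE->.
have [r /andP[/eqP rr dr]] : exists r, (rho r == r) && (3 * deg r <= Q * n)%N.
  apply/existsP; apply: contraT; rewrite negb_exists => /forallP big.
  suff : (3 * (Q * n).+1 <= 3 * (n * Q))%N by rewrite leq_mul2l /= mulnC ltnn.
  rewrite -sumdeg big_distrr /=.
  apply: leq_trans (_ : \sum_(r | rho r == r) (Q * n).+1 <= _)%N.
    by rewrite sum_nat_cond_const leq_mul2r roots3.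
  by apply: leq_sum => r rr; move: (big r); rewrite rr ltnNge.
pose S := [set i | rho i == r].
pose cnt l := (\sum_(t < Q) (rho (U l t) == r))%N.
pose e : {ffun 'I_n -> 'I_Q} := [ffun l => Ordinal (ltn_pmod (cnt l) Q_gt0)].
have eE : e \in low_exponents n Q.
  rewrite inE; apply: leq_trans dr; rewrite leq_mul2l /=.
  by apply: leq_sum => l _; rewrite ffunE leq_mod.
have rS : r \in S by rewrite inE rr.
pose g (x : I -> 'rV[F]_n) : F := [forall (i | i \notin S), x i == x (rho i)]%:R *
  \prod_l \prod_(t | U l t \notin S) x (U l t) ord0 l.
apply: (@eq_sliceable _ _ _ _ _ (fun x => block_monomial S e x * g x)); last first.
  apply: sliceable_block => //; first exact: SSrho.
  move=> x y xy; rewrite /g; congr ((_ : bool)%:R * _).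
    apply: eq_forallb_in => i; rewrite inE => iS.
    by rewrite !xy ?inE ?rhoK.
  by apply: eq_bigr => l _; apply: eq_bigr => t tS; rewrite xy // inE.
move=> x xB; rewrite /block_monomial; case: pickP => [i iS|/(_ r)]; last by rewrite rS.
have -> : delta x = (constant_on S x)%:R * [forall (i | i \notin S), x i == x (rho i)]%:R.
  rewrite /delta -natrM mulnb; congr (_ : bool)%:R;
    apply/forallP/andP => [d|[/constant_onP cS /forall_inP d] j].
    split; last by apply/forall_inP.
    apply/constant_onP => j k; rewrite !inE => /eqP jr /eqP kr.
    by rewrite (eqP (d j)) (eqP (d k)) jr kr.
  case: (boolP (j \in S)) => [jS|/d//]; apply/eqP/cS => //.
  by move: jS; rewrite !inE rhoK.
case: (boolP (constant_on S x)) => [/constant_onP cS|_]; last by rewrite !mul0r.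
rewrite !mul1r /g mulrCA; congr (_ * _).
rewrite /monomial_value -big_split; apply: eq_bigr => l _ /=.
rewrite [RHS](bigID (fun t => U l t \in S)) /=; congr (_ * _).
rewrite (eq_bigr (fun=> x i ord0 l)) => [|t tS]; last by rewrite (cS (U l t) i).
rewrite prodr_const ffunE /=.
rewrite (_ : #|_| = cnt l); last first.
  by rewrite -sum1_card big_mkcond; apply: eq_bigr => t _; rewrite [t \in _]inE;
    case: (rho _ == r).
(* Exponents only matter modulo [Q]. *)
rewrite {2}(divn_eq (cnt l) Q) exprD mulnC exprM expQ ?expr1n ?mul1r //.
by have := xB i; rewrite inE => /forallP.
Qed.
End ZeroSum.

(** * Sets without three-term progressions *)

Lemma boolr_neq0 (R : nzRingType) (b : bool) : (b%:R != 0 :> R) = b.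
Proof. by case: b; rewrite ?oner_eq0 ?eqxx. Qed.

Lemma ap3_free_zero_sum (V : finZmodType) (A : {set V}) (x : 'I_3 -> V) :
  (forall v : V, v *+ 3 = 0) -> ap3_free A -> (forall i, x i \in A) ->
  (\sum_i x i == 0) = constant_on [set: 'I_3] x.
Proof.
move=> V3 Afree xA; apply/eqP/constant_onP => [|xc]; last first.
  rewrite (eq_bigr (fun=> x ord0)) => [|i _]; last by apply: xc; rewrite inE.
  by rewrite sumr_const card_ord V3.
set a := x ord0; set b := x (lift ord0 ord0); set c := x ord_max.
have -> : \sum_i x i = a + b + c.
  rewrite !big_ord_recl big_ord0 addr0 addrA; congr (_ + _ + x _).
  exact: val_inj.
move=> abc0.
(* In characteristic three, a zero-sum triple is a progression of difference
   [b - a]. *)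
have ec : c = a + (b - a) *+ 2.
  apply: (addrI (a + b)); rewrite abc0 -(V3 b) (mulrS b 2) mulrnBl.
  by rewrite addrACA -mulr2n [b + (_ - _)]addrA [RHS]addrC subrK.
have ab : a = b.
  apply/eqP; rewrite eq_sym -subr_eq0; apply: contraT => d0.
  by case: (Afree a (b - a) d0); split; rewrite -?ec ?[a + _]addrC ?subrK -?ec //; apply: xA.
have ac : a = c by rewrite ec ab subrr mul0rn addr0.
have xa i : x i = a.
  case: i => [[|[|[|m]]] im] //.
  - by congr x; apply: val_inj.
  - by rewrite ab; congr x; apply: val_inj.
  - by rewrite ac; congr x; apply: val_inj.
by move=> i k _ _; rewrite !xa.
Qed.

Lemma cap_set_box_bound (F : finFieldType) (n Q : nat) (A : {set 'rV[F]_n}) :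
  #|F| = Q.+1 -> 3%N \in [pchar F] -> A \subset punctured_box F n -> ap3_free A ->
  (#|A| <= 3 * #|low_exponents n Q|)%N.
Proof.
move=> cardF F3 AB Afree.
pose SS : {set {set 'I_3}} := [set [set i] | i : 'I_3].
have <- : #|SS| = 3%N by rewrite card_imset ?card_ord //; apply: set1_inj.
have sl := @sliceable_zero_sum F n Q 'I_3 cardF SS id ord0.
apply: (sliceable_diagonal_bound ord0 _ AB (sl _ _ _)) => //.
- move=> _ /imsetP[i _ ->]; split; first by apply/set0Pn; exists i; rewrite inE.
  by rewrite properEcard subsetT cards1 cardsT card_ord.
- by rewrite (_ : [set r | _] = setT) ?cardsT ?card_ord //; apply/setP => r; rewrite !inE eqxx.
- by move=> r _; apply/imsetP; exists r => //; apply/setP => i; rewrite !inE.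
move=> x xA; rewrite (_ : [forall i, _] = true) ?mul1r; last by apply/forallP.
rewrite boolr_neq0; apply: (ap3_free_zero_sum _ Afree) => // v.
by rewrite -scaler_nat pcharf0 ?scale0r.
Qed.

(** * Distinctness as a signed sum over forests *)

Section Forests.
Variables (R : comNzRingType) (k : nat).
Implicit Types (c : {ffun 'I_k -> 'I_k}).

(** The vertex [j] hangs from the vertex [c j]; it is a root when [c j = j]. *)
Definition forest c := [forall j, c j <= j]%N.

Definition forest_sign c : R :=
  \prod_(j < k) (if c j == j then 1 else if (c j < j)%N then -1 else 0).

Definition roots c := [set j | c j == j].

(** Agreement along the edges of [c], hence on each tree. *)
Definition follows (X : eqType) c (x : 'I_k -> X) := [forall j, x j == x (c j)].

Lemma forest_sign0 c : ~~ forest c -> forest_sign c = 0.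
Proof.
rewrite negb_forall => /existsP[j cj]; rewrite /forest_sign (bigD1 j) //=.
rewrite -ltnNge in cj; rewrite ltnNge ltnW // ifF ?mul0r //.
by apply/eqP => e; rewrite e ltnn in cj.
Qed.

Lemma iter_forest_root c i : forest c -> c (iter k c i) = iter k c i.
Proof.
move=> /forallP fc.
(* Each step that does not stay at a root decreases the index. *)
suff H m : c (iter m c i) = iter m c i \/ (iter m c i + m <= i)%N.
  case: (H k) => // le; have := leq_trans (leq_addl _ _) le.
  by rewrite leqNgt ltn_ord.
elim: m => [|m [IH|IH]]; first by right; rewrite addn0.
  by left; rewrite /= IH.
have [e|ne] := eqVneq (c (iter m c i)) (iter m c i); first by left; rewrite /= e.
right; rewrite addnS; apply: leq_trans IH; rewrite -addSn leq_add2r /=.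
by rewrite ltn_neqAle fc andbT.
Qed.

Lemma iter_fixed (T : Type) (f : T -> T) m (a : T) : f a = a -> iter m f a = a.
Proof. by move=> fa; elim: m => //= m ->. Qed.

Lemma follows_iter (X : eqType) c (x : 'I_k -> X) : forest c ->
  follows c x = [forall j, x j == x (iter k c j)].
Proof.
move=> fc; apply/forallP/forallP => xc j.
  by elim: {2}k => //= m /eqP ->.
by rewrite (eqP (xc (c j))) -iterSr /= iter_forest_root.
Qed.

(** The sum expands the product over [j] of [1 - #{i < j | x i = x j}].  All
factors are one when [x] is injective.  Otherwise the factor vanishes at the
first [j] whose value has already occurred, since it occurred only once. *)
Lemma distinctness_forests (X : eqType) (x : 'I_k -> X) :
  \sum_c forest_sign c * (follows c x)%:R = (injectiveb x)%:R :> R.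
Proof.
transitivity (\prod_(j < k) \sum_(i < k)
   (if i == j then 1 else if (i < j)%N then -1 else 0) * (x j == x i)%:R : R).
  rewrite bigA_distr_bigA; apply: eq_bigr => c _; rewrite big_split; congr (_ * _).
  case: (boolP (follows c x)) => [/forallP xc|].
    by rewrite big1 // => j _; rewrite xc.
  by rewrite negb_forall => /existsP[j /negbTE xj]; rewrite (bigD1 j) //= xj mul0r.
have fE j : \sum_(i < k) (if i == j then 1 else if (i < j)%N then -1 else 0) *
              (x j == x i)%:R = 1 - \sum_(i < k | (i < j)%N) (x j == x i)%:R :> R.
  rewrite (bigD1 j) //= !eqxx mul1r; congr (_ + _).
  rewrite -sumrN big_mkcond [RHS]big_mkcond; apply: eq_bigr => i _ /=.
  case: eqP => [->|_]; first by rewrite ltnn.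
  by case: ifP; rewrite ?mulN1r ?mul0r.
case: injectiveP => [xI|/injectiveP].
  rewrite big1 // => j _; rewrite fE big1 ?subr0 // => i ij.
  by rewrite (inj_eq xI) -val_eqE (gtn_eqF ij).
move=> /injectivePn[i0 [i1 ne01 e01]].
have dup : exists j : 'I_k, [exists i : 'I_k, (i < j)%N && (x j == x i)].
  case: (ltngtP i0 i1) => [lt|lt|/val_inj e]; last by rewrite e eqxx in ne01.
    by exists i1; apply/existsP; exists i0; rewrite lt e01 eqxx.
  by exists i0; apply/existsP; exists i1; rewrite lt e01 eqxx.
case: dup => j1 dup1.
case: (arg_minnP (P := fun j : 'I_k => [exists i : 'I_k, (i < j)%N && (x j == x i)])
        (@nat_of_ord k) dup1) => j /existsP[i /andP[ij xij]] jmin.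
rewrite (bigD1 j) //= fE (bigD1 i) //= xij big1 ?addr0 ?subrr ?mul0r //.
move=> i' /andP[i'j ne]; case: eqP => // xi'.
have x2 : x i' = x i by rewrite -xi' (eqP xij).
case: (ltngtP i i') => [lt|lt|/val_inj e]; last by rewrite e eqxx in ne.
  suff : (j <= i')%N by rewrite leqNgt i'j.
  by apply: jmin; apply/existsP; exists i; rewrite lt x2 eqxx.
suff : (j <= i)%N by rewrite leqNgt ij.
by apply: jmin; apply/existsP; exists i'; rewrite lt x2 eqxx.
Qed.

(** Same expansion as in [distinctness_forests], all equalities being true and a
variable marking the roots. *)
Lemma forest_sign_polynomial :
  \sum_c forest_sign c *: 'X^#|roots c| = \prod_(j < k) ('X - (j : nat)%:R%:P) :> {poly R}.
Proof.
transitivity (\prod_(j < k) \sum_(i < k)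
   (if i == j then 'X else if (i < j)%N then -1 else 0) : {poly R}).
  rewrite bigA_distr_bigA; apply: eq_bigr => c _.
  rewrite -mul_polyC rmorph_prod /= -prodr_const [X in _ * X]big_mkcond -big_split /=.
  apply: eq_bigr => j _; rewrite inE; case: eqP => _; first by rewrite mul1r.
  by case: ifP; rewrite mulr1 ?polyCN.
apply: eq_bigr => j _; rewrite (bigD1 j) //= eqxx; congr (_ + _).
rewrite (eq_bigr (fun i : 'I_k => if (i < j)%N then -1 else 0)) => [|i /negbTE->//].
rewrite -big_mkcondr /= (eq_bigl (fun i : 'I_k => (i < j)%N)) => [|i]; last first.
  by case: eqP => [->|]; rewrite ?ltnn.
rewrite (big_ord_narrow (ltnW (ltn_ord j))) sumr_const card_ord.
by rewrite mulNrn polyC_natr.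
Qed.
End Forests.

(** * Sets without zero-sum families of prime size *)

Lemma prod_XsubC_prime_char (F : fieldType) (p : nat) : p \in [pchar F] ->
  \prod_(j < p) ('X - (j : nat)%:R%:P) = 'X^p - 'X :> {poly F}.
Proof.
move=> Fp; have p_pr := pcharf_prime Fp; have p1 := prime_gt1 p_pr.
have szp : size ('X^p - 'X : {poly F}) = p.+1.
  by rewrite size_polyDl size_polyXn // size_polyN size_polyX ltnS.
have lp : lead_coef ('X^p - 'X : {poly F}) = 1.
  by rewrite lead_coefDl ?lead_coefXn // size_polyN size_polyX size_polyXn ltnS.
pose rs : seq F := [seq j%:R | j <- index_iota 0 p].
have := @all_roots_prod_XsubC _ ('X^p - 'X) rs; rewrite lp scale1r => -> //.
- by rewrite big_map big_mkord.
- by rewrite szp size_map size_iota subn0.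
- apply/allP=> _ /mapP[j _ ->]; rewrite rootE !hornerE /=.
  by rewrite -(pFrobenius_autE Fp) pFrobenius_aut_nat subrr.
rewrite uniq_rootsE map_inj_in_uniq ?iota_uniq // => i j.
rewrite !mem_index_iota /=; wlog le_ij : i j / (i <= j)%N => [W ip jp e|ip jp /eqP].
  by case/orP: (leq_total i j) => le; [|symmetry]; apply: W.
rewrite eq_sym -subr_eq0 -natrB // -(dvdn_pcharf Fp) => dv.
apply/eqP; rewrite eqn_leq le_ij -subn_eq0 -leqn0 leqNgt.
apply: contraL dv => ji; rewrite gtnNdvd //; exact: leq_ltn_trans (leq_subr _ _) jp.
Qed.

(** Grading the forests by their number of roots, this adds up the coefficients
of [X^p - X] in degrees at least three. *)
Lemma sum_forest_sign_many_roots (F : fieldType) (p : nat) :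
  p \in [pchar F] -> (2 < p)%N ->
  \sum_(c : {ffun 'I_p -> 'I_p} | (2 < #|roots c|)%N) forest_sign F c = 1.
Proof.
move=> Fp p2.
have coefE m : \sum_(c : {ffun 'I_p -> 'I_p} | #|roots c| == m) forest_sign F c =
               ('X^p - 'X : {poly F})`_m.
  rewrite -(prod_XsubC_prime_char Fp) -forest_sign_polynomial coef_sum.
  rewrite big_mkcond; apply: eq_bigr => c _; rewrite coefZ coefXn eq_sym.
  by case: eqP; rewrite ?mulr1 ?mulr0.
have rootsB (c : {ffun 'I_p -> 'I_p}) : (#|roots c| < p.+1)%N.
  by rewrite ltnS -[leqRHS]card_ord max_card.
rewrite (partition_big (fun c => Ordinal (rootsB c)) (fun m : 'I_p.+1 => (2 < m)%N)) //=.
rewrite (eq_bigr (fun m : 'I_p.+1 => (m == ord_max)%:R)) => [|m m2].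
  rewrite (bigD1 ord_max) //= eqxx big1 ?addr0 // => m /andP[_ /negbTE->] //.
rewrite (eq_bigl (fun c => #|roots c| == m)) => [|c]; last first.
  by rewrite -val_eqE /=; case: eqP => [->|]; rewrite ?m2 ?andbF.
by rewrite coefE coefB coefXn coefX -val_eqE /= [_ == 1%N]gtn_eqF ?subr0 // ltnW.
Qed.

(** With two trees, of sizes [m] and [p - m], the sum is [m] times the difference
of the two values of [x], and [m] is invertible modulo [p]. *)
Lemma two_roots_constant (V : zmodType) (p : nat) (c : {ffun 'I_p -> 'I_p})
    (x : 'I_p -> V) :
  prime p -> (forall v : V, v *+ p = 0) ->
  (forall v m, (0 < m < p)%N -> v *+ m = 0 -> v = 0 :> V) ->
  forest c -> (#|roots c| <= 2)%N -> follows c x -> \sum_i x i = 0 ->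
  constant_on [set: 'I_p] x.
Proof.
move=> p_pr Vp Vm fc r2 xc x0.
have rt i : iter p c i \in roots c by rewrite inE iter_forest_root.
have xr i : x i = x (iter p c i) by move: xc; rewrite follows_iter // => /forallP/(_ i)/eqP.
suff H r s : r \in roots c -> s \in roots c -> x r = x s.
  by apply/constant_onP=> i k _ _; rewrite xr [RHS]xr; apply: H.
move=> rr rs; have [->//|ne] := eqVneq r s.
have rE i : iter p c i != r -> iter p c i = s.
  move=> nr; apply/eqP; apply: contraLR r2 => ns; rewrite -ltnNge.
  rewrite (cardD1 r) rr (cardD1 s) inE /= eq_sym ne rs (cardD1 (iter p c i)) !inE.
  by rewrite ns nr iter_forest_root // eqxx.
pose m := #|[set i | iter p c i == r]|.
have [m0 mp] : (0 < m)%N /\ (m < p)%N.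
  split; first by apply/card_gt0P; exists r; rewrite inE iter_fixed //; move: rr;
    rewrite inE => /eqP.
  rewrite -[X in (_ < X)%N]card_ord -cardsT; apply: proper_card; apply/properP; split=> //.
  exists s; rewrite !inE // iter_fixed 1?eq_sym //; by move: rs; rewrite inE => /eqP.
apply/eqP; rewrite -subr_eq0; apply/eqP; apply: (Vm _ m); rewrite ?m0 //.
rewrite mulrnBl.
have : \sum_i x i = x r *+ m + x s *+ (p - m).
  rewrite (bigID (fun i => iter p c i == r)) /=; congr (_ + _).
    rewrite (eq_bigr (fun=> x r)) => [|i /eqP e]; last by rewrite xr e.
    by rewrite sumr_const /m cardsE.
  rewrite (eq_bigr (fun=> x s)) => [|i /rE e]; last by rewrite xr e.
  rewrite sumr_const; congr (_ *+ _).
  have := cardsC [set i | iter p c i == r]; rewrite card_ord => eC.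
  rewrite -[X in (X - _)%N]eC addKn.
  by apply: eq_card => i; rewrite !inE.
by rewrite x0 mulrnBr ?Vp ?sub0r // ltnW.
Qed.

(** The trees of a forest with at least three roots are proper nonempty subsets
of the index set, whence the factor [2 ^ p]. *)
Lemma zero_sum_free_box_bound (F : finFieldType) (n Q p : nat) (A : {set 'rV[F]_n}) :
  #|F| = Q.+1 -> p \in [pchar F] -> (2 < p)%N -> A \subset punctured_box F n ->
  (forall x : 'I_p -> 'rV[F]_n, injective x -> (forall i, x i \in A) -> \sum_i x i <> 0) ->
  (#|A| <= 2 ^ p * #|low_exponents n Q|)%N.
Proof.
move=> cardF Fp p2 AB Afree; have p_pr := pcharf_prime Fp.
have Vp (v : 'rV[F]_n) : v *+ p = 0 by rewrite -scaler_nat pcharf0 ?scale0r.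
have Vm (v : 'rV[F]_n) m : (0 < m < p)%N -> v *+ m = 0 -> v = 0.
  move=> /andP[m0 mp] /eqP; rewrite -scaler_nat scaler_eq0 -(dvdn_pcharf Fp).
  by rewrite gtnNdvd //= => /eqP.
pose SS : {set {set 'I_p}} := [set S | (S != set0) && (S \proper [set: 'I_p])].
have cardSS : (#|SS| <= 2 ^ p)%N.
  have <- : #|powerset [set: 'I_p]| = (2 ^ p)%N by rewrite card_powerset cardsT card_ord.
  by apply/subset_leq_card/subsetP => S _; rewrite inE subsetT.
apply: leq_trans (leq_mul cardSS (leqnn _)).
pose i0 : 'I_p := Ordinal (ltnW (ltnW p2)).
pose T (x : 'I_p -> 'rV[F]_n) : F :=
  \sum_(c | forest c && (2 < #|roots c|)%N)
    forest_sign F c * ((follows c x)%:R * (\sum_i x i == 0)%:R).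
apply: (sliceable_diagonal_bound (T := T) i0 _ AB) => [S||x xA].
- by rewrite inE => /andP[].
- apply: sliceable_sum => c /andP[fc c3]; apply: sliceableZ.
  apply: (@eq_sliceable _ _ _ _ _ (fun x : 'I_p -> 'rV[F]_n =>
    [forall i, x i == x (iter p c i)]%:R * (\sum_i x i == 0)%:R)).
    by move=> x _; rewrite -follows_iter.
  have rootE r : (iter p c r == r) = (r \in roots c).
    apply/eqP/idP => [e|]; last by rewrite inE => /eqP; apply: iter_fixed.
    by rewrite inE -e iter_forest_root.
  apply: sliceable_zero_sum => //.
  - by move=> i; rewrite [LHS]iter_fixed // iter_forest_root.
  - by rewrite (_ : [set r | _] = roots c) //; apply/setP => r; rewrite [LHS]inE rootE.
  move=> r /eqP; rewrite rootE => rr; rewrite inE; apply/andP; split.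
    by apply/set0Pn; exists r; rewrite inE rootE.
  have [s sr sne] : exists2 s, s \in roots c & s != r.
    have : (0 < #|roots c :\ r|)%N by move: c3; rewrite (cardsD1 r) rr add1n ltnS;
      apply: leq_trans.
    by case/card_gt0P => s /setD1P[sr s_root]; exists s.
  apply/properP; split=> //; exists s; rewrite ?inE //.
  by rewrite iter_fixed //; apply/eqP; move: sr; rewrite inE.
case: (boolP (constant_on _ x)) => [/constant_onP xc|xnc].
  have x0 : \sum_i x i = 0.
    rewrite (eq_bigr (fun=> x i0)) ?sumr_const ?card_ord ?Vp // => i _.
    by apply: xc; rewrite inE.
  have -> : T x = \sum_(c : {ffun 'I_p -> 'I_p} | (2 < #|roots c|)%N) forest_sign F c;
    last first.
    by rewrite sum_forest_sign_many_roots ?oner_eq0.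
  rewrite /T [RHS](bigID (@forest p)) /= [X in _ = _ + X]big1 => [|c /andP[_ /forest_sign0->]] //.
  rewrite addr0; apply: eq_big => [c|c _]; first by rewrite andbC.
  rewrite x0 eqxx (_ : follows c x) ?mulr1 //.
  by apply/forallP=> j; apply/eqP/xc; rewrite inE.
apply/negbTE; rewrite negbK; apply/eqP.
have [x0|nx0] := eqVneq (\sum_i x i) 0; last first.
  by rewrite /T big1 // => c _; rewrite (negbTE nx0) !mulr0.
have ninj : ~~ injectiveb x by apply/injectiveP => xI; case: (Afree x).
transitivity (\sum_c forest_sign F c * (follows c x)%:R); last first.
  by rewrite distinctness_forests (negbTE ninj).
rewrite [RHS](bigID (fun c => forest c && (2 < #|roots c|)%N)) /= [X in _ = _ + X]big1.
  by rewrite addr0; apply: eq_bigr => c _; rewrite x0 eqxx !mulr1.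
move=> c; rewrite negb_and -leqNgt; case: (boolP (forest c)) => [fc /= c2|fc _]; last first.
  by rewrite forest_sign0 ?mul0r.
case: (boolP (follows c x)) => [xc|]; rewrite ?mulr0 //.
by case/negP: xnc; apply: (two_roots_constant p_pr Vp Vm fc c2 xc).
Qed.

(** * Counting exponents of low degree *)

Definition vartheta_values (R : realType) (q : nat) (rho : R) : R :=
  (\sum_(i < q - 1) rho ^+ i) * rho `^ (- ((q - 1)%:R / 3)).

Lemma ge_vartheta (R : realType) (q : nat) (L : R) :
  (forall rho : R, 0 < rho < 1 -> L <= vartheta_values q rho) -> L <= vartheta R q.
Proof.
move=> H; apply: lb_le_inf.
  by exists (vartheta_values q 2^-1), 2^-1 => //=; lra.
by move=> _ [rho rho01 <-]; apply: H.
Qed.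

Lemma vartheta_le (R : realType) (q : nat) (rho : R) :
  0 < rho < 1 -> vartheta R q <= vartheta_values q rho.
Proof.
move=> rho01; apply: ge_inf; last by exists rho.
exists 0 => _ [r /andP[r0 _] <-].
by rewrite mulr_ge0 ?powR_ge0 // sumr_ge0 // => i _; rewrite exprn_ge0 // ltW.
Qed.

(** The power [(1 + rho + ... ) ^+ n] is the sum of [rho ^+ degree] over all
exponent vectors, and [rho ^+ degree >= rho `^ (Q * n / 3)] for those of low
degree. *)
Lemma card_low_exponents_le (R : realType) (n Q : nat) (rho : R) : 0 < rho < 1 ->
  #|low_exponents n Q|%:R <= vartheta_values Q.+1 rho ^+ n.
Proof.
move=> /andP[r0 r1]; rewrite /vartheta_values subn1 /= exprMn.
have -> : (\sum_(i < Q) rho ^+ i) ^+ n =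
    \sum_(e : {ffun 'I_n -> 'I_Q}) rho ^+ (\sum_l e l).
  rewrite -{1}[n]card_ord -prodr_const bigA_distr_bigA.
  by apply: eq_bigr => e _; rewrite expr_sum.
have -> : (rho `^ (- (Q%:R / 3))) ^+ n = (rho `^ (Q%:R / 3 * n%:R))^-1.
  by rewrite -powR_mulrn ?powR_ge0 // -powRrM mulNr powRN.
rewrite ler_pdivlMr ?powR_gt0 //.
rewrite -sumr_const mulr_suml [leRHS](bigID (mem (low_exponents n Q))) /=.
rewrite ler_wpDr ?sumr_ge0 // => [e _|]; first by rewrite exprn_ge0 // ltW.
apply: ler_sum => e; rewrite inE mul1r => le.
rewrite -powR_mulrn ?(ltW r0) //; apply: ger_powR; first by rewrite r0 ltW.
rewrite mulrAC ler_pdivlMr // -!natrM ler_nat; by rewrite mulnC.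
Qed.

Lemma card_low_exponents_vartheta (R : realType) (n Q : nat) : (0 < n)%N ->
  #|low_exponents n Q|%:R <= vartheta R Q.+1 ^+ n.
Proof.
move=> n0; set M := #|_|.
have rt : (M%:R `^ n%:R^-1 : R) ^+ n = M%:R.
  by rewrite -powR_mulrn ?powR_ge0 // -powRrM mulVf ?pnatr_eq0 -?lt0n // powRr1.
have le : M%:R `^ n%:R^-1 <= vartheta R Q.+1.
  apply: ge_vartheta => rho rho01; rewrite -(ler_pXn2r n0) ?nnegrE ?powR_ge0 //.
    by rewrite rt card_low_exponents_le.
  apply: mulr_ge0; rewrite ?powR_ge0 // sumr_ge0 // => i _; rewrite exprn_ge0 // ltW //.
  by case/andP: rho01.
rewrite -rt lerXn2r ?nnegrE ?powR_ge0 //; exact: le_trans (powR_ge0 _ _) le.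
Qed.

(** * Vectors over a finite field as vectors over the prime field *)

Lemma rV_additive_bij (F : finFieldType) (p k n : nat) : prime p ->
  #|F| = (p ^ k)%N ->
  exists phi : {additive 'rV[F]_n -> 'rV['F_p]_(k * n)}, bijective phi.
Proof.
move=> p_pr cF; have Fp := card_finPcharP cF p_pr.
have := pprimeChar_vectAxiom Fp; rewrite {1}[#|_|]cF pfactorK // => -[v v_lin [w vK wK]].
pose phi (x : 'rV[F]_n) : 'rV['F_p]_(k * n) :=
  mxvec (\matrix_(i, l) v (x ord0 l) ord0 i).
have vB (a b : F) : v (a - b) = v a - v b.
  have := v_lin (-1) b a; rewrite scaleN1r ![- _ + _]addrC => ->.
  by rewrite scaleN1r addrC.
have phiB : {morph phi : x y / x - y}.
  by move=> x y; rewrite -linearB; congr mxvec; apply/matrixP => i l; rewrite !mxE vB !mxE.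
pose phiM := GRing.isZmodMorphism.Build _ _ phi phiB.
pose f : {additive 'rV[F]_n -> 'rV['F_p]_(k * n)} := HB.pack phi phiM.
exists f; exists (fun y => \row_l w (\row_i vec_mx y i l)) => [x|y].
  apply/rowP => l; rewrite mxE /= /phi mxvecK -[RHS]vK; congr w.
  by apply/rowP => i; rewrite !mxE.
rewrite /= /phi -[RHS]vec_mxK; congr mxvec; apply/matrixP => i l.
by rewrite mxE [X in v X]mxE wK mxE.
Qed.

Lemma ap3_free_image (V W : finZmodType) (phi : {additive V -> W}) (A : {set V}) :
  bijective phi -> ap3_free A <-> ap3_free [set phi x | x in A].
Proof.
move=> phi_bij; have phi_inj := bij_inj phi_bij; have [psi _ psiK] := phi_bij.
split=> Afree x d d0 [].
  rewrite -(psiK x) -(psiK d) -raddfMn -!raddfD !(mem_imset _ _ phi_inj) => x1 x2 x3.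
  case: (Afree (psi x) (psi d)); last by split.
  by apply: contraNneq d0 => psid; rewrite -(psiK d) psid raddf0.
move=> x1 x2 x3; case: (Afree (phi x) (phi d)); first by rewrite raddf_eq0.
by rewrite -raddfMn -!raddfD !(mem_imset _ _ phi_inj).
Qed.

(** * Numerical bounds *)

Lemma vartheta_valuesE (R : realType) (Q : nat) (rho : R) : 0 < rho ->
  vartheta_values Q.+1 rho = \sum_(i < Q) expR ((i%:R - Q%:R / 3) * ln rho).
Proof.
move=> r0; rewrite /vartheta_values subn1 /= mulr_suml; apply: eq_bigr => i _.
rewrite -powR_mulrn ?ltW // -powRD; last by rewrite (gt_eqF r0) implybT.
by rewrite /powR gt_eqF.
Qed.

Lemma vartheta_values_cube (R : realType) (Q : nat) (t : R) : 0 < t ->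
  vartheta_values Q.+1 (t ^+ 3) = (\sum_(i < Q) t ^+ (3 * i)) / t ^+ Q.
Proof.
move=> t0; rewrite /vartheta_values subn1 /=; congr (_ * _).
  by apply: eq_bigr => i _; rewrite exprM.
rewrite -powR_mulrn ?ltW // -powRrM mulrN mulrCA divff ?pnatr_eq0 // mulr1.
by rewrite powRN powR_mulrn // ltW.
Qed.

Lemma vartheta_le_cube (R : realType) (Q : nat) (t : R) : 0 < t < 1 ->
  vartheta R Q.+1 <= (\sum_(i < Q) t ^+ (3 * i)) / t ^+ Q.
Proof.
move=> /andP[t0 t1]; rewrite -vartheta_values_cube //; apply: vartheta_le.
by rewrite exprn_gt0 //= exprn_ilt1 // ltW.
Qed.

(** The terms of the sum defining [vartheta] at [rho] are
[t ^+ (3 * i) / t ^+ Q * expR ((3 * i - Q) * s)], where [s] is the logarithm of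
[rho ^ (1/3) / t].  Lower the coefficients to [w] and bound [expR] below by its
tangent at zero: the terms linear in [s] cancel.  Near the minimizer, taking
[w] close to the true coefficients loses little. *)
Lemma vartheta_tangent_bound (R : realType) (Q : nat) (t : R) (w : seq R) :
  0 < t ->
  (forall i, (i < Q)%N -> 0 <= w`_i /\ w`_i * t ^+ Q <= t ^+ (3 * i)) ->
  \sum_(i < Q) w`_i * ((3 * i)%:R - Q%:R) = 0 ->
  \sum_(i < Q) w`_i <= vartheta R Q.+1.
Proof.
move=> t0 wt w0; apply: ge_vartheta => rho /andP[r0 _].
rewrite vartheta_valuesE //; set s := (ln rho - 3 * ln t) / 3.
apply: le_trans (_ : \sum_(i < Q) w`_i * (1 + ((3 * i)%:R - Q%:R) * s) <= _).
  under [leRHS]eq_bigr do rewrite mulrDr mulr1 mulrA.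
  by rewrite big_split /= -mulr_suml w0 mul0r addr0.
apply: ler_sum => i _; have [wi0 wit] := wt i (ltn_ord i).
have -> : (i%:R - Q%:R / 3) * ln rho =
          ((3 * i)%:R - Q%:R) * ln t + ((3 * i)%:R - Q%:R) * s.
  by rewrite /s natrM; field.
rewrite expRD; apply: le_trans (ler_wpM2l wi0 (expR_ge1Dx _)) _.
rewrite ler_wpM2r ?expR_ge0 // mulrBl expRB !expRM_natl lnK ?posrE //.
by rewrite ler_pdivlMr ?exprn_gt0.
Qed.

(** The cube root of the minimizer [rho = 0.84936976...] for [q = 9]. *)
Definition cube_root9 (R : realType) : R :=
  decimal R [:: 0; 9; 4; 7; 0; 3; 4; 0; 6; 0; 4; 1; 9; 1]%N.

(** The numbers [t ^+ (3 * i) / t ^+ 8] at [t = cube_root9], rounded down to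
fourteen decimals.  The third and fourth are lowered slightly further, to make
the sum weighted by [3 * i - 8] vanish exactly. *)
Definition weights9 (R : realType) : seq R := map (decimal R)
  [:: [:: 1; 5; 4; 5; 5; 2; 2; 0; 6; 3; 3; 1; 3; 0; 6];
      [:: 1; 3; 1; 2; 7; 1; 9; 7; 0; 9; 1; 9; 4; 8; 4];
      [:: 1; 1; 1; 4; 9; 8; 4; 4; 2; 8; 7; 5; 1; 3; 2];
      [:: 0; 9; 4; 7; 0; 3; 4; 0; 6; 0; 4; 1; 9; 0; 9];
      [:: 0; 8; 0; 4; 3; 8; 2; 0; 9; 5; 7; 9; 8; 7; 5];
      [:: 0; 6; 8; 3; 2; 1; 7; 8; 3; 0; 3; 6; 5; 3; 1];
      [:: 0; 5; 8; 0; 3; 0; 4; 5; 6; 6; 9; 0; 5; 5; 6];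
      [:: 0; 4; 9; 2; 8; 9; 3; 1; 5; 2; 6; 7; 3; 4; 2]]%N.

Lemma vartheta9_ge (R : realType) :
  decimal R [:: 7; 4; 8; 1; 0; 5; 7; 9; 0; 7; 3; 5]%N <= vartheta R 9.
Proof.
apply: le_trans (@vartheta_tangent_bound R 8 (cube_root9 R) (weights9 R) _ _ _).
- rewrite !big_ord_recl big_ord0 /weights9 /decimal /=. lra.
- rewrite /cube_root9 /decimal /=. lra.
- rewrite /weights9 /cube_root9.
  case=> [|[|[|[|[|[|[|[|]]]]]]]] // _; rewrite /= /decimal /=; by split; lra.
- rewrite !big_ord_recl big_ord0 /= /bump !leq0n !add1n /weights9 /decimal /= !natrM. lra.
Qed.

Lemma vartheta9_le (R : realType) :
  vartheta R 9 <= decimal R [:: 7; 4; 8; 1; 0; 5; 7; 9; 0; 7; 4; 5]%N.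
Proof.
have t01 : 0 < cube_root9 R < 1 by rewrite /cube_root9 /decimal /=; lra.
apply: le_trans (vartheta_le_cube 8 t01) _.
rewrite ler_pdivrMr ?exprn_gt0 //; last by case/andP: t01.
rewrite !big_ord_recl big_ord0 /cube_root9 /decimal /=. lra.
Qed.

(** The cube root of the minimizer [rho = 0.87458081...] for [q = 5]. *)
Definition cube_root5 (R : realType) : R :=
  decimal R [:: 0; 9; 5; 6; 3; 1; 2; 8; 2; 9; 6; 6; 0; 3]%N.

(** As [weights9], with [t ^+ (3 * i) / t ^+ 4] at [t = cube_root5]; here the
second weight is the one lowered further. *)
Definition weights5 (R : realType) : seq R := map (decimal R)
  [:: [:: 1; 1; 9; 5; 6; 3; 8; 9; 9; 5; 9; 5; 7; 2; 2];
      [:: 1; 0; 4; 5; 6; 8; 2; 9; 2; 8; 2; 0; 5; 6; 3];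
      [:: 0; 9; 1; 4; 5; 3; 4; 2; 2; 8; 1; 7; 2; 8; 8];
      [:: 0; 7; 9; 9; 8; 3; 4; 0; 9; 1; 1; 3; 7; 7; 5]]%N.

Lemma vartheta5_ge (R : realType) :
  decimal R [:: 3; 9; 5; 5; 6; 9; 0; 2; 4; 3; 4; 5]%N <= vartheta R 5.
Proof.
apply: le_trans (@vartheta_tangent_bound R 4 (cube_root5 R) (weights5 R) _ _ _).
- rewrite !big_ord_recl big_ord0 /weights5 /decimal /=. lra.
- rewrite /cube_root5 /decimal /=. lra.
- rewrite /weights5 /cube_root5.
  case=> [|[|[|[|]]]] // _; rewrite /= /decimal /=; by split; lra.
- rewrite !big_ord_recl big_ord0 /= /bump !leq0n !add1n /weights5 /decimal /= !natrM. lra.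
Qed.

Lemma vartheta5_le (R : realType) :
  vartheta R 5 <= decimal R [:: 3; 9; 5; 5; 6; 9; 0; 2; 4; 3; 5; 5]%N.
Proof.
have t01 : 0 < cube_root5 R < 1 by rewrite /cube_root5 /decimal /=; lra.
apply: le_trans (vartheta_le_cube 4 t01) _.
rewrite ler_pdivrMr ?exprn_gt0 //; last by case/andP: t01.
rewrite !big_ord_recl big_ord0 /cube_root5 /decimal /=. lra.
Qed.

Lemma sqrt_between (R : realType) (a l u : R) : 0 <= l -> 0 <= u ->
  l ^+ 2 <= a <= u ^+ 2 -> l <= Num.sqrt a <= u.
Proof.
move=> l0 u0 /andP[la au].
rewrite -[l]ger0_norm // -[u]ger0_norm // -!sqrtr_sqr.
by rewrite !ler_sqrt ?la ?au ?sqr_ge0 // (le_trans _ la) ?sqr_ge0.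
Qed.

(** Since [x0] is a root of [2 * X^2 - X - 4], powers of [x0] reduce to linear
expressions in [x0]. *)
Lemma gamma_cube (R : realType) :
  gamma R ^+ 3 = 27 / 512 * (207 + 33 * Num.sqrt 33).
Proof.
rewrite /gamma; set x := x0 R.
have s2 : Num.sqrt 33 ^+ 2 = 33 :> R by rewrite sqr_sqrtr.
have sE : Num.sqrt 33 = 4 * x - 1 :> R by rewrite /x /x0; lra.
have x_gt0 : 0 < x by rewrite /x /x0; have := sqrtr_ge0 (33 : R); lra.
have x2 : x ^+ 2 = (x + 4) / 2 by move: s2; rewrite sE; lra.
have x3 : x ^+ 3 = (9 * x + 4) / 4 by rewrite exprS x2; move: x2; lra.
have x4 : x ^+ 4 = (17 * x + 36) / 8 by rewrite exprS x3; move: x2; lra.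
have -> : (1 + x + x ^+ 2) = 3 * (x + 2) / 2 by rewrite x2; lra.
have xp : (x `^ (- (4 / 3))) ^+ 3 = (x ^+ 4)^-1.
  rewrite -(@powR_mulrn _ (x `^ _)) ?powR_ge0 // -powRrM mulNr divfK ?pnatr_eq0 //.
  by rewrite powRN powR_mulrn // ltW.
rewrite exprMn xp.
apply: (mulIf (lt0r_neq0 (exprn_gt0 4 x_gt0))).
rewrite divfK ?gt_eqF ?exprn_gt0 // x4 sE; lra.
Qed.

Lemma gamma_sqr_between (R : realType) :
  decimal R [:: 7; 5; 9; 0; 6; 0; 1; 4; 2; 8; 6; 5]%N <= gamma R ^+ 2
    <= decimal R [:: 7; 5; 9; 0; 6; 0; 1; 4; 2; 8; 7; 5]%N.
Proof.
have /andP[sl su] : decimal R [:: 5; 7; 4; 4; 5; 6; 2; 6; 4; 6; 5; 3; 8]%N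
    <= Num.sqrt 33 <= decimal R [:: 5; 7; 4; 4; 5; 6; 2; 6; 4; 6; 5; 3; 9]%N.
  by apply: sqrt_between; rewrite /decimal /=; lra.
have e : (gamma R ^+ 2) ^+ 3 = (gamma R ^+ 3) ^+ 2 by rewrite -!exprM.
rewrite -(@ler_pXn2r _ 3) ?nnegrE ?sqr_ge0 //; last by rewrite /decimal /=; lra.
rewrite -[X in _ && X](@ler_pXn2r _ 3) ?nnegrE ?sqr_ge0 //; last by rewrite /decimal /=; lra.
have s2 : Num.sqrt 33 ^+ 2 = 33 :> R by rewrite sqr_sqrtr.
(* The square of [gamma ^+ 3] is linear in [sqrt 33]. *)
rewrite e gamma_cube; move: sl su s2; set s := Num.sqrt _; rewrite /decimal /= => sl su s2.
by apply/andP; split; lra.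
Qed.

Theorem corollary5p4 (R : realType) (n : nat) (n_ge1 : (1 <= n)%N) :
  (* (i) *)
  [/\ forall F : finFieldType, #|F| = 9%N ->
        [/\ exists phi : {additive 'rV[F]_n -> 'rV['F_3]_(2 * n)},
              bijective phi,
            forall phi : {additive 'rV[F]_n -> 'rV['F_3]_(2 * n)},
              bijective phi ->
              forall A : {set 'rV[F]_n},
                A \subset punctured_box F n ->
                (ap3_free A <-> cap_set [set phi x | x in A])
          & forall A : {set 'rV[F]_n},
              A \subset punctured_box F n -> ap3_free A ->
              #|A|%:R <= 3 * vartheta R 9 ^+ n],
      rounds_to (vartheta R 9) [:: 7; 4; 8; 1; 0; 5; 7; 9; 0; 7; 4]%N,
      vartheta R 9 < gamma R ^+ 2
    & rounds_to (gamma R ^+ 2) [:: 7; 5; 9; 0; 6; 0; 1; 4; 2; 8; 7]%N] /\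
  (* (ii) *)
  [/\ forall F : finFieldType, #|F| = 5%N ->
        forall A : {set 'rV[F]_n},
          A \subset punctured_box F n -> no_five_zero_sum A ->
          #|A|%:R <= 120 * vartheta R 5 ^+ n,
      rounds_to (vartheta R 5) [:: 3; 9; 5; 5; 6; 9; 0; 2; 4; 3; 5]%N,
      vartheta R 5 < 2 * Num.sqrt 5
    & rounds_to (2 * Num.sqrt 5 : R) [:: 4; 4; 7; 2; 1; 3; 5; 9; 5; 5; 0]%N].
Proof.
have [g_ge g_le] := andP (gamma_sqr_between R).
have [v9_ge v9_le] := (vartheta9_ge R, vartheta9_le R).
have [v5_ge v5_le] := (vartheta5_ge R, vartheta5_le R).
have /andP[s5_ge s5_le] : decimal R [:: 2; 2; 3; 6; 0; 6; 7; 9; 7; 7; 4; 8]%N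
    <= Num.sqrt 5 <= decimal R [:: 2; 2; 3; 6; 0; 6; 7; 9; 7; 7; 5]%N.
  by apply: sqrt_between; rewrite /decimal /=; lra.
rewrite /rounds_to !ler_norml /=.
move: g_ge g_le v9_ge v9_le v5_ge v5_le s5_ge s5_le; rewrite /decimal /=.
move=> g_ge g_le v9_ge v9_le v5_ge v5_le s5_ge s5_le.
split; split; rewrite ?ler_norml; try (by lra); try (by apply/andP; split; lra).
  move=> F cF; split.
  - by apply: (@rV_additive_bij F 3 2 n).
  - by move=> phi phi_bij A _; apply: ap3_free_image.
  move=> A AB Afree; have F3 : 3%N \in [pchar F] by apply: (@card_finPcharP F 3 2).
  apply: le_trans (_ : (3 * #|low_exponents n 8|)%:R <= _).
    by rewrite ler_nat; apply: cap_set_box_bound.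
  by rewrite natrM ler_pM2l // card_low_exponents_vartheta.
move=> F cF A AB Afree; have F5 : 5%N \in [pchar F] by apply: (@card_finPcharP F 5 1).
apply: le_trans (_ : (2 ^ 5 * #|low_exponents n 4|)%:R <= _).
  rewrite ler_nat; apply: (@zero_sum_free_box_bound F n 4 5 A) => // x x_inj xA sum0.
  apply: (Afree [set x i | i : 'I_5]).
  - by apply/subsetP=> _ /imsetP[i _ ->]; apply: xA.
  - by rewrite card_imset ?card_ord.
  - by rewrite big_imset /= ?sum0 // => i j _ _; apply: x_inj.
rewrite natrM; apply: ler_pM; rewrite ?ler_nat //.
exact: card_low_exponents_vartheta.
Qed.
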